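(* Let $n$ and $k$ be positive integers and let $\boldsymbol{i}=(i_1,\dots,i_k)\in[n]^k$ be an integer sequence. For every integer $m>n+2k$, the vacillating tableaux $P^k_m(\boldsymbol{i})$ and $P^k_{m+1}(\boldsymbol{i})$ have the same simplified version, i.e. $(P^k_m(\boldsymbol{i}))^*=(P^k_{m+1}(\boldsymbol{i}))^*$: the two sequences of integer partitions become equal after removing the first row from each integer partition in the sequences.
   Context: Notation: $[n]=\{1,2,\dots,n\}$. Integer partitions are identified with their Young diagrams (English notation, rows left-justified, row $j$ having $\lambda_j$ boxes, rows numbered from the top). A partial tableau is a filling of the boxes of an integer partition (its shape) with distinct positive integers increasing along rows (left to right) and down columns. RSK row insertion $x\xrightarrow{RSK}T$, for a partial tableau $T$ and a positive integer $x$ not in $T$: let $R$ be the first row of $T$. While $x$ is less than some element of $R$: let $y$ be the smallest element of $R$ greater than $x$; replace $y$ in $R$ by $x$; set $x:=y$ and let $R$ be the next row. When $x$ is not less than any element of $R$, place $x$ at the end of $R$ (which is possibly empty). The result is a partial tableau. Jeu de taquin deletion $x\xleftarrow{jdt}T$, for a partial tableau $T$ and an entry $x$ of $T$: let $c$ be the box containing $x$, at position $(i,j)$ (row $i$, column $j$). While the position $(i,j)$ of $x$ is not a corner (a box that is both at the end of its row and at the end of its column), exchange $x$ with the smaller of the entries at positions $(i+1,j)$ and $(i,j+1)$ (if only one of these exists, exchange with that one), and update $(i,j)$ to be the new position of $x$. When $x$ is in a corner, delete that box. The result is a partial tableau. The vacillating tableau $P^k_m(\boldsymbol{i})$, for $\boldsymbol{i}=(i_1,\dots,i_k)\in[m]^k$: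 let $T^{(0)}$ be the tableau of one row of shape $(m)$ with entries $1,2,\dots,m$. For integers $j=0,1,\dots,k-1$ put $T^{(j+\frac12)}=\left(i_{j+1}\xleftarrow{jdt}T^{(j)}\right)$ and $T^{(j+1)}=\left(i_{j+1}\xrightarrow{RSK}T^{(j+\frac12)}\right)$. Let $\lambda^{(j)}$ be the shape of $T^{(j)}$ for every index $j\in\{0,\frac12,1,1\frac12,\dots,k\}$. Then $P^k_m(\boldsymbol{i})=(\lambda^{(0)},\lambda^{(\frac12)},\lambda^{(1)},\dots,\lambda^{(k-\frac12)},\lambda^{(k)})$. Simplified version: for an integer partition $\lambda=(\lambda_1,\lambda_2,\dots,\lambda_t)$, let $\lambda^*=(\lambda_2,\dots,\lambda_t)$ be obtained by removing the first part. For a sequence $P=(\lambda^{(j)}: j=0,\frac12,1,\dots,k)$ of partitions, $P^*=((\lambda^{(j)})^*: j=0,\frac12,1,\dots,k)$. *)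

(* Defs.v *)
From mathcomp Require Export all_boot.

Set Implicit Arguments.
Unset Strict Implicit.
Unset Printing Implicit Defensive.

(* A partial tableau is the list of its nonempty rows, from the top; the
   integer partition [shape T] is the list of its (nonzero) parts.
   Rows, columns and list positions are numbered from 0. *)
Definition tableau := seq (seq nat).
Definition partition := seq nat.

(* The head of the sorted list is the smallest element of R greater than x. *)
Fixpoint rsk_insert (x : nat) (T : tableau) : tableau :=
  match T with
  | [::] => [:: [:: x]]
  | R :: T' =>
      match sort leq [seq z <- R | x < z] with
      | [::] => rcons R x :: T'
      | y :: _ => [seq if z == y then x else z | z <- R] :: rsk_insert y T'
      end
  end.

Definition has_box (T : tableau) (i j : nat) : bool := j < size (nth [::] T i).

Definition entry (T : tableau) (i j : nat) : nat := nth 0 (nth [::] T i) j.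

Definition set_entry (T : tableau) (i j x : nat) : tableau :=
  set_nth [::] T i (set_nth 0 (nth [::] T i) j x).

Definition exchange (T : tableau) (i j i' j' : nat) : tableau :=
  set_entry (set_entry T i j (entry T i' j')) i' j' (entry T i j).

Definition is_corner (T : tableau) (i j : nat) : bool :=
  ~~ has_box T i.+1 j && ~~ has_box T i j.+1.

(* Only meant for a corner; a row that becomes empty disappears. *)
Definition delete_box (T : tableau) (i j : nat) : tableau :=
  [seq R <- set_nth [::] T i (take j (nth [::] T i)) | R != [::]].

Definition jdt_next (T : tableau) (i j : nat) : nat * nat :=
  if has_box T i.+1 j && has_box T i j.+1 then
    if entry T i.+1 j < entry T i j.+1 then (i.+1, j) else (i, j.+1)
  else if has_box T i.+1 j then (i.+1, j) else (i, j.+1).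

Fixpoint jdt_slide (fuel : nat) (T : tableau) (i j : nat) : tableau :=
  if fuel is fuel'.+1 then
    if is_corner T i j then delete_box T i j
    else let: (i', j') := jdt_next T i j in
         jdt_slide fuel' (exchange T i j i' j') i' j'
  else T.

(* The slide starts at the box containing x.  It never visits a box twice, so
   the number of boxes of T is enough fuel for it to end in a corner. *)
Definition jdt_delete (x : nat) (T : tableau) : tableau :=
  let i := find (fun R => x \in R) T in
  let j := index x (nth [::] T i) in
  jdt_slide (sumn (shape T)) T i j.

(* T^(0), T^(1/2), T^(1), ..., T^(k) for T = T^(0) and s = (i_1, ..., i_k). *)
Fixpoint tableau_sequence (T : tableau) (s : seq nat) : seq tableau :=
  if s is x :: s' then
    let T' := jdt_delete x T in
    T :: T' :: tableau_sequence (rsk_insert x T') s'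
  else [:: T].

(* P^k_m(i): the entry at position p of this list is lambda^(p/2). *)
Definition vacillating_tableau (k m : nat) (i : k.-tuple nat) : seq partition :=
  [seq shape T | T <- tableau_sequence [:: iota 1 m] i].

Definition simplified (P : seq partition) : seq partition :=
  [seq behead lambda | lambda <- P].

(* Main.v *)
Require Import Defs.
From mathcomp Require Import all_boot zify.

(** Why only the first row sees the difference between [m] and [m + 1].

Start from the one-row tableaux 1, ..., m and 1, ..., m, M with M = m + 1.  At
every time the second tableau is the first one with M appended to its first
row: [R :: B] against [rcons R M :: B].  The rows below the first are then
equal, and so are the simplified shapes.

Deletion preserves this relation ([jdt_delete_first_row]).  A slide that starts
below the first row never sees R.  A slide in R makes the same choices in both
tableaux, because M exceeds every entry it is compared with; they can only part
at the last box of R.  If there is a box below it, the entry there is smaller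
than M and both slides go down; otherwise the second slide exchanges x and M,
and M takes the place that x has left.

Insertion of x preserves the relation as long as R contains an entry larger
than x ([rsk_insert_first_row]): the smallest such entry is not M, so both
tableaux bump the same entry.  If R had no such entry, M would be bumped in the
second tableau.

It remains to see that R never runs out of entries larger than n.  All of
n + 1, ..., m are there at the start; a deletion takes no entry other than
x <= n out of R, and an insertion takes out at most one.  So k insertions are
harmless when m - n >= k ([tableau_sequence_first_row]).  To avoid following the
distinctness of all entries of the tableau, the proof carries a duplicate-free
list [big] of values larger than n that occur in R, and drops the bumped entry
from it. *)

(** * Slides and the number of steps allowed to them *)

Lemma has_boxE T i j : has_box T i j = (j < nth 0 (shape T) i).
Proof. by rewrite /has_box nth_shape. Qed.

Lemma shape_set_entry T i j v :
  has_box T i j -> shape (set_entry T i j v) = shape T.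
Proof.
rewrite /set_entry /has_box.
elim: T i => [|R T IH] [|i] //= ltj; last by rewrite -[in RHS](IH i).
by rewrite size_set_nth (maxn_idPr ltj).
Qed.

Lemma shape_exchange T i j i' j' :
  has_box T i j -> has_box T i' j' -> shape (exchange T i j i' j') = shape T.
Proof.
move=> b b'; rewrite /exchange shape_set_entry ?shape_set_entry //.
by rewrite has_boxE shape_set_entry // -has_boxE.
Qed.

Lemma jdt_nextP T i j : ~~ is_corner T i j ->
  (jdt_next T i j = (i.+1, j) /\ has_box T i.+1 j) \/
  (jdt_next T i j = (i, j.+1) /\ has_box T i j.+1).
Proof.
rewrite /is_corner /jdt_next.
by case: has_box; case: has_box => //=; try case: ifP; auto.
Qed.

Lemma jdt_slideS f T i j :
  jdt_slide f.+1 T i j =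
  if is_corner T i j then delete_box T i j else
  let p := jdt_next T i j in jdt_slide f (exchange T i j p.1 p.2) p.1 p.2.
Proof. by rewrite /=; case: jdt_next. Qed.

Arguments jdt_slide : simpl never.

(** A slide visits boxes in reading order, so the number of boxes from (i, j) on
bounds its length, and any larger fuel gives the same result.  The two tableaux
that are compared have different numbers of boxes, hence different fuels. *)
Lemma jdt_slide_fuel f f' T i j :
  has_box T i j ->
  sumn (drop i (shape T)) - j <= f -> sumn (drop i (shape T)) - j <= f' ->
  jdt_slide f T i j = jdt_slide f' T i j.
Proof.
have drop_box i1 j1 T1 : has_box T1 i1 j1 ->
    j1 < nth 0 (shape T1) i1 /\
    sumn (drop i1 (shape T1))
    = nth 0 (shape T1) i1 + sumn (drop i1.+1 (shape T1)).
  rewrite has_boxE => b; split=> //; rewrite (drop_nth 0) //.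
  by rewrite ltnNge; apply: contraTN b => ?; rewrite nth_default.
elim: f f' T i j => [|f IH] [|f'] T i j box.
- by [].
- by have [lt e] := drop_box _ _ _ box; rewrite e; lia.
- by have [lt e] := drop_box _ _ _ box; rewrite e; lia.
have [lt e] := drop_box _ _ _ box; rewrite e => le le'; rewrite !jdt_slideS /=.
case: ifPn => // /jdt_nextP [] [-> box'] /=;
  have [lt1 e1] := drop_box _ _ _ box';
  apply: IH; rewrite ?has_boxE shape_exchange //; lia.
Qed.

Lemma jdt_delete_fuel f f' x T :
  let i := find (fun S => x \in S) T in
  let j := index x (nth [::] T i) in
  0 < f -> 0 < f' -> sumn (shape T) <= f -> sumn (shape T) <= f' ->
  jdt_slide f T i j = jdt_slide f' T i j.
Proof.
move=> i j f0 f0' le le'.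
have [hasT|] := boolP (has (fun S : seq nat => x \in S) T).
  have lesum : sumn (drop i (shape T)) - j <= sumn (shape T).
    rewrite (leq_trans (leq_subr _ _)) //.
    by rewrite -{2}(cat_take_drop i (shape T)) sumn_cat leq_addl.
  apply: jdt_slide_fuel; rewrite ?(leq_trans lesum) //.
  by rewrite /has_box index_mem; apply: (nth_find [::] hasT).
(* When x is absent, [find] returns the position after the last row: a corner
   whose deletion is reached with any positive fuel. *)
move=> /hasNfind iT.
case: f f' f0 f0' {le le'} => [|f] [|f'] // _ _; rewrite !jdt_slideS.
suff -> : is_corner T i j by [].
by rewrite /is_corner /has_box /i iT !nth_default.
Qed.

(** * Bounds on the entries *)

Lemma all_set_nth (A : Type) (P : pred A) x0 s i v :
  P x0 -> P v -> all P s -> all P (set_nth x0 s i v).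
Proof.
move=> P0 Pv; elim: s i => [|y s IH] [|i] /=; rewrite ?Pv //.
- by move=> _; rewrite P0 -cat_nseq all_cat all_nseq P0 orbT /= Pv.
- by case/andP.
- by case/andP=> -> /IH ->.
Qed.

Lemma all_nth_default (A : Type) (P : pred A) x0 s i :
  P x0 -> all P s -> P (nth x0 s i).
Proof.
move=> P0 /(all_nthP x0) Ps; case: (ltnP i (size s)) => [/Ps//|le].
by rewrite nth_default.
Qed.

(** [P 0] is assumed since [entry] reads 0 outside of the tableau and [set_nth]
pads with 0; the property of interest is being smaller than M. *)
Section Entries.

Variables (P : pred nat) (P0 : P 0).

Lemma all_entry T i j : all (all P) T -> P (entry T i j).
Proof.
by move=> PT; apply: (all_nth_default _ P 0) => //; apply: all_nth_default.
Qed.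

Lemma all_set_entry T i j v :
  P v -> all (all P) T -> all (all P) (set_entry T i j v).
Proof.
move=> Pv PT; apply: all_set_nth => //; apply: all_set_nth => //.
exact: all_nth_default.
Qed.

Lemma all_exchange T i j i' j' :
  all (all P) T -> all (all P) (exchange T i j i' j').
Proof. by move=> PT; rewrite !all_set_entry ?all_entry. Qed.

Lemma all_delete_box T i j : all (all P) T -> all (all P) (delete_box T i j).
Proof.
move=> PT; rewrite /delete_box all_filter.
apply: (@sub_all _ (all P)) => [R PR|]; first exact/implyP.
apply: all_set_nth => //; have: all P (nth [::] T i) by exact: all_nth_default.
by rewrite -{1}(cat_take_drop j (nth [::] T i)) all_cat => /andP[].
Qed.

Lemma all_jdt_delete x T : all (all P) T -> all (all P) (jdt_delete x T).
Proof.
rewrite /jdt_delete; move: (sumn _) (find _ _) (index _ _) => f i j.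
elim: f T i j => // f IH T i j PT; rewrite jdt_slideS /=.
by case: ifP => _; [apply: all_delete_box | apply/IH/all_exchange].
Qed.

Lemma all_rsk_insert x T :
  P x -> all (all P) T -> all (all P) (rsk_insert x T).
Proof.
elim: T x => [|R T IH] x /= Px; first by rewrite Px.
case/andP=> PR PT; case E: sort => [|y s] /=; first by rewrite all_rcons Px PR.
have: y \in sort leq [seq z <- R | x < z] by rewrite E mem_head.
rewrite mem_sort mem_filter => /andP[_ yR].
rewrite IH ?(allP PR) // andbT all_map; apply/allP=> z zR /=.
by case: eqP => // _; apply: (allP PR).
Qed.

End Entries.

(** * Deletion and the first row *)

Lemma set_nth_rcons (A : Type) (x0 : A) s z j v :
  j < size s -> set_nth x0 (rcons s z) j v = rcons (set_nth x0 s j v) z.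
Proof. by elim: s j => [|y s IH] [|j] //= /IH ->. Qed.

Lemma set_nth_swap_last (A : Type) (x0 : A) s x y :
  set_nth x0 (set_nth x0 (rcons (rcons s x) y) (size s) y) (size s).+1 x
  = rcons (rcons s y) x.
Proof. by elim: s => //= z s ->. Qed.

Lemma jdt_slide_below f R B i j :
  R != [::] -> jdt_slide f (R :: B) i.+1 j = R :: jdt_slide f B i j.
Proof.
move=> R0; elim: f B i j => // f IH B i j; rewrite !jdt_slideS.
rewrite /is_corner /has_box /=; case: ifP => _.
  by rewrite /delete_box /= R0.
have -> : jdt_next (R :: B) i.+1 j =
    ((jdt_next B i j).1.+1, (jdt_next B i j).2).
  rewrite /jdt_next /has_box /entry /=; do 2?case: ifP => //=.
exact: IH.
Qed.

(** The two slides run in parallel until the one in [R :: B] leaves R downwards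
or stops at the end of R; in the second case the other one takes an additional
step, which explains [f.+1].  The assumption [has] keeps R from disappearing
when its last box is deleted. *)
Lemma jdt_slide_first_row M f R B j :
    j < size R -> all (all (fun z => z < M)) B -> 0 < M ->
    has (predC1 (nth 0 R j)) R -> size R - j + sumn (shape B) <= f ->
  exists R' B',
  [/\ jdt_slide f (R :: B) 0 j = R' :: B',
      jdt_slide f.+1 (rcons R M :: B) 0 j = rcons R' M :: B' &
      forall z, z \in R -> z != nth 0 R j -> z \in R'].
Proof.
move=> + BM M0; elim: f R j => [|f IH] R j ltj hasR lef; first by lia.
rewrite jdt_slideS (jdt_slideS f.+1).
have -> : is_corner (rcons R M :: B) 0 j = false.
  by rewrite /is_corner /has_box /= size_rcons ltnS ltj andbF.
have neq0 (s : seq nat) : 0 < size s -> s != [::] by case: s.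
have mem_index z : z \in R -> z != nth 0 R j ->
    exists l, [/\ l < size R, nth 0 R l = z & l != j].
  move=> zR zj; exists (index z R); rewrite index_mem nth_index //; split=> //.
  by apply: contraNneq zj => <-; rewrite nth_index.
(* The choices differ only in a corner of [R :: B]: at the end of R, a box below
   holds an entry smaller than M, so M does not attract the slide. *)
have nextM : jdt_next (rcons R M :: B) 0 j =
    if is_corner (R :: B) 0 j then (0, j.+1) else jdt_next (R :: B) 0 j.
  rewrite /jdt_next /is_corner /has_box /entry /= size_rcons ltnS ltj andbT.
  case: (j < size (nth [::] B 0)) => /=; last by case: (j.+1 < size R).
  rewrite nth_rcons; case: (ltnP j.+1 (size R)) => //= le.
  have -> : (j.+1 == size R) by rewrite eqn_leq ltj.
  by have := @all_entry (fun z => z < M) M0 B 0 j BM; rewrite /entry => ->.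
have exchange_right S l : exchange (S :: B) 0 l 0 l.+1 =
    set_nth 0 (set_nth 0 S l (nth 0 S l.+1)) l.+1 (nth 0 S l) :: B by [].
have exchange_down S : exchange (S :: B) 0 j 1 j =
    set_nth 0 S j (entry B 0 j) :: set_entry B 0 j (nth 0 S j) by [].
rewrite nextM; case: ifPn => [corner|/[dup] ncorner /jdt_nextP [] [-> box]];
  cbv beta zeta iota delta [fst snd].
- have [b1 szR] : ~~ has_box B 0 j /\ size R = j.+1.
    by case/andP: corner; rewrite /has_box /= => -> ?; split=> //; lia.
  have jle : size (take j R) = j by rewrite size_takel // szR.
  have takeP z : z \in R -> z != nth 0 R j -> z \in take j R.
    move=> zR zj; have [l [lt <- lj]] := mem_index z zR zj.
    have ltlj : l < j by lia.
    by rewrite -(nth_take 0 ltlj) mem_nth ?jle.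
  have take0 : take j R != [::].
    by case/hasP: hasR => z zR /(takeP z zR); case: take.
  exists (take j R), [seq S <- B | S != [::]]; split=> //.
    by rewrite /delete_box /= take0.
  rewrite exchange_right jdt_slideS.
  have -> : set_nth 0 (set_nth 0 (rcons R M) j (nth 0 (rcons R M) j.+1)) j.+1
      (nth 0 (rcons R M) j) = rcons (rcons (take j R) M) (nth 0 R j).
    rewrite -(set_nth_swap_last _ 0) jle -(take_nth 0 ltj) -szR take_size.
    by rewrite !nth_rcons ltj ltnn szR eqxx.
  have -> : is_corner (rcons (rcons (take j R) M) (nth 0 R j) :: B) 0 j.+1.
    rewrite /is_corner /has_box /= !size_rcons jle ltnn andbT.
    by move: b1; rewrite /has_box -!leqNgt => /leq_trans; apply.
  rewrite /delete_box /=.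
  have -> : take j.+1 (rcons (rcons (take j R) M) (nth 0 R j)) =
      rcons (take j R) M.
    by rewrite -[in RHS]cats1 -!cats1 take_size_cat // size_cat jle addn1.
  by case: (take j R) take0.
- rewrite !exchange_down.
  exists (set_nth 0 R j (entry B 0 j)),
    (jdt_slide f (set_entry B 0 j (nth 0 R j)) 0 j).
  have shB := shape_set_entry B 0 j (nth 0 R j) box.
  rewrite nth_rcons ltj set_nth_rcons //; split.
  + by rewrite jdt_slide_below // neq0 // size_set_nth leq_max.
  + rewrite jdt_slide_below; last by rewrite neq0 // size_rcons.
    congr (_ :: _); apply: jdt_slide_fuel; rewrite ?shB ?drop0; try lia.
    by rewrite has_boxE shB -has_boxE.
  + move=> z zR zj; have [l [lt <- lj]] := mem_index z zR zj.
    rewrite -[nth 0 R l](_ : nth 0 (set_nth 0 R j (entry B 0 j)) l = _).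
      by rewrite mem_nth // size_set_nth leq_max lt orbT.
    by rewrite nth_set_nth /= (negPf lj).
- rewrite !exchange_right.
  rewrite /has_box /= in box.
  set R1 := set_nth 0 (set_nth 0 R j (nth 0 R j.+1)) j.+1 (nth 0 R j).
  have sz1 : size R1 = size R by rewrite !size_set_nth; lia.
  have nth1 : nth 0 R1 j.+1 = nth 0 R j by rewrite nth_set_nth /= eqxx.
  have mem1 z : z \in R -> z != nth 0 R j -> z \in R1.
    move=> zR zj; have [l [lt <- lj]] := mem_index z zR zj.
    have [->|lj1] := eqVneq l j.+1.
      suff <- : nth 0 R1 j = nth 0 R j.+1 by rewrite mem_nth ?sz1.
      by rewrite nth_set_nth /= ltn_eqF // nth_set_nth /= eqxx.
    suff <- : nth 0 R1 l = nth 0 R l by rewrite mem_nth ?sz1.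
    by rewrite nth_set_nth /= (negPf lj1) nth_set_nth /= (negPf lj).
  have [|||R' [B' [-> eM mem']]] := IH R1 j.+1; rewrite ?nth1 ?sz1 //.
  + case/hasP: hasR => z zR zj; apply/hasP; exists z => //; exact: mem1.
  + by lia.
  exists R', B'; split=> //; last first.
    by move=> z zR zj; apply: mem'; rewrite ?nth1 // mem1.
  by rewrite !nth_rcons ltj box !set_nth_rcons ?size_set_nth //; lia.
Qed.

Lemma jdt_delete_first_row M x R B :
    x < M -> all (all (fun z => z < M)) B -> has (predC1 x) R ->
  exists R' B',
  [/\ jdt_delete x (R :: B) = R' :: B',
      jdt_delete x (rcons R M :: B) = rcons R' M :: B' &
      forall z, z \in R -> z != x -> z \in R'].
Proof.
move=> xM BM hasR; have R0 : R != [::] by case: (R) hasR.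
have M0 : 0 < M by lia.
have R0' : 0 < size R by case: (R) R0.
rewrite /jdt_delete /= mem_rcons inE ltn_eqF //= size_rcons addSn.
case: ifP => xR /=.
  have jle : index x R < size R by rewrite index_mem.
  rewrite -[in index x (rcons R M)]cats1 index_cat xR.
  have := jdt_slide_first_row M (size R + sumn (shape B)) R B (index x R).
  by rewrite nth_index //; apply=> //; rewrite leq_add2r leq_subr.
rewrite !jdt_slide_below //; last by case: (R).
set l := find _ B; set j := index x _.
exists R, (jdt_slide (size R + sumn (shape B)) B l j); split=> //.
congr (_ :: _); apply: jdt_delete_fuel; rewrite ?addn_gt0 ?R0' ?leq_addl //.
exact/leqW/leq_addl.
Qed.

(** * Insertion and the first row *)

Lemma sort_rcons_max M s : all (fun z => z < M) s ->
  sort leq (rcons s M) = rcons (sort leq s) M.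
Proof.
move=> sM; apply: (sorted_eq leq_trans anti_leq).
- exact: (sort_sorted leq_total).
- have := sort_sorted leq_total s; have := sM; rewrite -(all_sort _ leq).
  case: (sort leq s) => // z r zrM /= zr; rewrite rcons_path zr /=.
  exact/ltnW/(allP zrM)/mem_last.
- by rewrite perm_sort perm_rcons perm_sym perm_rcons perm_cons perm_sort.
Qed.

(** The entry y larger than x forces a bump inside R: the maximal entry M then
is not the smallest one above x, and it stays at its place.  Here b is the bumped
entry, the only one that R can lose. *)
Lemma rsk_insert_first_row M x y R B :
    x < M -> all (fun z => z < M) R -> y \in R -> x < y ->
  exists b R' B',
  [/\ rsk_insert x (R :: B) = R' :: B',
      rsk_insert x (rcons R M :: B) = rcons R' M :: B' &
      forall z, z \in R -> z != b -> z \in R'].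
Proof.
move=> xM RM yR xy /=.
rewrite filter_rcons xM sort_rcons_max; last first.
  by rewrite all_filter; apply: sub_all RM => z zM; apply/implyP.
case E: (sort leq _) => [|b s] /=.
  have : y \in sort leq [seq z <- R | x < z] by rewrite mem_sort mem_filter xy.
  by rewrite E.
have : b \in sort leq [seq z <- R | x < z] by rewrite E mem_head.
rewrite mem_sort mem_filter => /andP[_ bR]; have bM := allP RM b bR.
exists b, [seq if z == b then x else z | z <- R], (rsk_insert b B).
split=> //; first by rewrite map_rcons gtn_eqF.
by move=> z zR zb; apply/mapP; exists z; rewrite // (negPf zb).
Qed.

(** * The whole sequence *)

(** The list [big] is the supply of entries larger than n in R.  Each insertion
uses up at most one of them, so one for each remaining step is enough to apply
[rsk_insert_first_row] every time. *)
Lemma tableau_sequence_first_row n M s big R B :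
    n < M -> (forall x, x \in s -> x <= n) ->
    all (all (fun z => z < M)) (R :: B) ->
    uniq big -> {subset big <= R} -> all (ltn n) big -> size s <= size big ->
  simplified [seq shape T | T <- tableau_sequence (R :: B) s]
  = simplified [seq shape T | T <- tableau_sequence (rcons R M :: B) s].
Proof.
move=> nM; elim: s big R B => //= x s IH big R B sn RBM ubig bigR bign les.
have [RM BM] := andP RBM; have M0 : 0 < M by lia.
have xn : x <= n by apply: sn; rewrite mem_head.
have bigx z : z \in big -> x < z by move/(allP bign); apply: leq_trans.
have [y ybig] : exists y, y \in big.
  by case: (big) les => // y; exists y; rewrite mem_head.
have hasR : has (predC1 x) R.
  by apply/hasP; exists y; rewrite ?bigR //= gtn_eqF ?bigx.
have [R1 [B1 [e1 e1M mem1]]] :=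
  jdt_delete_first_row M x R B (leq_ltn_trans xn nM) BM hasR.
have R1M : all (all (fun z => z < M)) (R1 :: B1).
  by rewrite -e1; exact: (all_jdt_delete (fun z => z < M)).
have big1 : {subset big <= R1}.
  by move=> z zb; apply: mem1; rewrite ?bigR // gtn_eqF ?bigx.
have [b [R2 [B2 [e2 e2M mem2]]]] := rsk_insert_first_row M x y R1 B1
  (leq_ltn_trans xn nM) (proj1 (andP R1M)) (big1 y ybig) (bigx y ybig).
rewrite e1 e1M e2 e2M /=; congr [:: _, _ & _].
apply: (IH (rem b big)).
- by move=> z zs; apply: sn; rewrite inE zs orbT.
- suff: all (all (fun z => z < M)) (rsk_insert x (R1 :: B1)) by rewrite e2.
  by apply: (all_rsk_insert (fun z => z < M)) R1M; lia.
- exact: rem_uniq.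
- by move=> z; rewrite mem_rem_uniq // inE => /andP[zb /big1 z1]; apply: mem2.
- by apply/allP=> z /mem_rem/(allP bign).
- have [bb|/rem_id->] := boolP (b \in big); last by lia.
  by rewrite size_rem //; case: (size big) les.
Qed.

Theorem theorem5 (n k : nat) (hn : 0 < n) (hk : 0 < k)
  (i : k.-tuple nat) (hi : forall x, x \in i -> 1 <= x <= n)
  (m : nat) (hm : n + 2 * k < m) :
  simplified (vacillating_tableau m i) = simplified (vacillating_tableau m.+1 i).
Proof.
rewrite /vacillating_tableau -[m.+1]addn1 iotaD cats1 add1n.
apply: (@tableau_sequence_first_row n _ _ (iota n.+1 (m - n))).
- by lia.
- by move=> x /hi/andP[].
- by rewrite /= andbT; apply/allP=> z; rewrite mem_iota; lia.
- exact: iota_uniq.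
- by move=> z; rewrite !mem_iota; lia.
- by apply/allP=> z; rewrite mem_iota /=; lia.
- by rewrite size_tuple size_iota; lia.
Qed.
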